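(* Let $\mathcal{M}^{n-1}_{n,n}\subset\mathcal{C}^{n\times n}$ be the variety of singular $n\times n$ matrices over $\mathcal{C}$. Then its real tropicalization equals its (complex) tropicalization: $$\mathrm{trop}_{\mathcal{R}}(\mathcal{M}^{n-1}_{n,n})=\mathrm{trop}_{\mathcal{C}}(\mathcal{M}^{n-1}_{n,n}).$$
   Context: Let $\mathcal{C}=\mathbb{C}\{\!\{t\}\!\}$ and $\mathcal{R}=\mathbb{R}\{\!\{t\}\!\}$ be the fields of complex and real Puiseux series, with valuation $\mathrm{val}(a)$ = the exponent of the lowest degree term of $a\ne0$. For a variety $X\subset\mathcal{C}^N$ and $\mathcal{K}\in\{\mathcal{C},\mathcal{R}\}$, let $\mathrm{trop}_{\mathcal{K}}(X)=\overline{\{\mathrm{val}(x): x\in X\cap(\mathcal{K}^* )^N\}}\subset\mathbb{R}^N$, with coordinatewise valuation and Euclidean closure. *)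

(* Defs.v *)
From HB Require Import structures.
From mathcomp Require Import all_boot all_order all_algebra.
From mathcomp Require Import all_classical all_reals topology.
From mathcomp Require Import complex.
From mathcomp Require Import ring zify.

Set Implicit Arguments.
Unset Strict Implicit.
Unset Printing Implicit Defensive.

Import Order.TTheory GRing.Theory Num.Theory.
Import numFieldTopology.Exports.

Local Open Scope classical_set_scope.
Local Open Scope ring_scope.

(* Coefficient functions of formal Puiseux series: the exponents have a common
   denominator d and are bounded below (by m / d). *)
Definition is_puiseux (K : fieldType) (f : rat -> K) : Prop :=
  exists (d : nat) (m : int), (0 < d)%N /\
    forall q, f q != 0 -> exists2 k : int, m <= k & q = k%:~R / d%:R.

(* [coef a q] is the coefficient of t^q in a. *)
Record puiseux (K : fieldType) : Type := Puiseux {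
  coef :> rat -> K;
  coef_puiseux : is_puiseux coef }.

HB.instance Definition _ (K : fieldType) := gen_eqMixin (puiseux K).
HB.instance Definition _ (K : fieldType) := gen_choiceMixin (puiseux K).

Section PuiseuxField.
Variable K : fieldType.
Implicit Types (a b c : puiseux K) (f g h : rat -> K) (d : nat) (m : int).

Lemma puiseux_ext a b : (forall q, a q = b q) -> a = b.
Proof.
case: a b => [f Pf] [g Pg] /= fg.
have E : f = g by apply/funext.
by subst g; rewrite (Prop_irrelevance Pf Pg).
Qed.

(* [pt d m 0], [pt d m 1], ... enumerate the exponents in (1/d)Z above m/d. *)
Definition pt d m (k : nat) : rat := (m + k%:Z)%:~R / d%:R.

Definition supp d m f := forall q, f q != 0 -> exists k, q = pt d m k.

Lemma suppP f d m :
  supp d m f <-> forall q, f q != 0 -> exists2 k : int, m <= k & q = k%:~R / d%:R.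
Proof.
split=> S q /S.
  by case=> k ->; exists (m + k%:Z) => //; lia.
case=> k mk ->; exists `|k - m|%N; rewrite /pt; congr (_%:~R / _); lia.
Qed.

Lemma is_puiseuxP f : is_puiseux f <-> exists d m, (0 < d)%N /\ supp d m f.
Proof.
by split=> -[d [m [d0 /suppP S]]]; exists d, m.
Qed.

Lemma supp_refine f d m e m' :
  (0 < d)%N -> (0 < e)%N -> m' <= m * e%:Z -> supp d m f -> supp (d * e) m' f.
Proof.
move=> d0 e0 mm' S q /S [k ->].
exists (absz ((m + k%:Z) * e%:Z - m')%R); rewrite /pt.
have -> : m' + (absz ((m + k%:Z) * e%:Z - m')%R)%:Z = (m + k%:Z) * e%:Z by nia.
rewrite intrM natrM -pmulrn invfM.
have dn : d%:R != 0 :> rat by rewrite pnatr_eq0; lia.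
have en : e%:R != 0 :> rat by rewrite pnatr_eq0; lia.
by field; rewrite dn en.
Qed.

Lemma supp_common2 f g : is_puiseux f -> is_puiseux g ->
  exists d m, [/\ (0 < d)%N, supp d m f & supp d m g].
Proof.
move=> /is_puiseuxP[d [m [d0 Sf]]] /is_puiseuxP[d' [m' [d'0 Sg]]].
exists (d * d')%N, (Num.min (m * d'%:Z) (m' * d%:Z)); split; first nia.
  by apply: supp_refine Sf => //; lia.
by rewrite mulnC; apply: supp_refine Sg => //; lia.
Qed.

Lemma supp_common3 f g h : is_puiseux f -> is_puiseux g -> is_puiseux h ->
  exists d m, [/\ (0 < d)%N, supp d m f, supp d m g & supp d m h].
Proof.
move=> /is_puiseuxP[d [m [d0 Sf]]] /supp_common2 H /H[d' [m' [d'0 Sg Sh]]].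
exists (d * d')%N, (Num.min (m * d'%:Z) (m' * d%:Z)); split; first nia.
- by apply: supp_refine Sf => //; lia.
- by rewrite mulnC; apply: supp_refine Sg => //; lia.
- by rewrite mulnC; apply: supp_refine Sh => //; lia.
Qed.

Lemma pt_inj d m : (0 < d)%N -> injective (pt d m).
Proof.
move=> d0 i j /(congr1 ( *%R^~ d%:R)).
rewrite /pt !divfK ?pnatr_eq0; try lia.
by move=> /intr_inj; lia.
Qed.

Lemma eq_supp d m f g : supp d m f -> supp d m g ->
  (forall k, f (pt d m k) = g (pt d m k)) -> f =1 g.
Proof.
move=> Sf Sg fg q.
have [f0|/Sf[k ->]//] := eqVneq (f q) 0.
by have [->|/Sg[k ->]//] := eqVneq (g q) 0.
Qed.

Lemma is_puiseux0 : is_puiseux (fun=> 0 : K).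
Proof. by exists 1%N, 0; split=> // q; rewrite eqxx. Qed.

Lemma is_puiseuxN a : is_puiseux (fun q => - a q).
Proof.
by case: (coef_puiseux a) => d [m [d0 S]]; exists d, m; split=> // q;
  rewrite oppr_eq0; apply: S.
Qed.

Lemma is_puiseuxD a b : is_puiseux (fun q => a q + b q).
Proof.
have [d [m [d0 Sa Sb]]] := supp_common2 (coef_puiseux a) (coef_puiseux b).
apply/is_puiseuxP; exists d, m; split=> // q.
have [->|/Sa//] := eqVneq (a q) 0.
by rewrite add0r => /Sb.
Qed.

Definition puiseux0 := Puiseux is_puiseux0.
Definition puiseuxN a := Puiseux (is_puiseuxN a).
Definition puiseuxD a b := Puiseux (is_puiseuxD a b).

Lemma puiseux_addA : associative puiseuxD.
Proof. by move=> a b c; apply: puiseux_ext => q /=; rewrite addrA. Qed.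
Lemma puiseux_addC : commutative puiseuxD.
Proof. by move=> a b; apply: puiseux_ext => q /=; rewrite addrC. Qed.
Lemma puiseux_add0 : left_id puiseux0 puiseuxD.
Proof. by move=> a; apply: puiseux_ext => q /=; rewrite add0r. Qed.
Lemma puiseux_addN : left_inverse puiseux0 puiseuxN puiseuxD.
Proof. by move=> a; apply: puiseux_ext => q /=; rewrite addNr. Qed.

HB.instance Definition _ := GRing.isZmodule.Build (puiseux K)
  puiseux_addA puiseux_addC puiseux_add0 puiseux_addN.

Lemma is_puiseux1 : is_puiseux (fun q => (q == 0)%:R : K).
Proof.
exists 1%N, 0; split=> // q; have [->|] := eqVneq q 0; last by rewrite eqxx.
by exists 0 => //; rewrite mul0r.
Qed.

Definition puiseux1 := Puiseux is_puiseux1.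

(* The sum has finitely many nonzero terms when f and g are Puiseux series
   (see [conv_pt]). *)
Definition conv f g (q : rat) : K := \sum_(r \in [set: rat]) (f r * g (q - r)).

Lemma ptB d m m' i k : (i <= k)%N ->
  pt d (m + m') k - pt d m i = pt d m' (k - i).
Proof.
move=> ik; rewrite /pt -mulrBl -intrB; congr (_%:~R / _); lia.
Qed.

Lemma conv_supp f g d m m' : (0 < d)%N ->
  supp d m f -> supp d m' g -> supp d (m + m') (conv f g).
Proof.
move=> d0 Sf Sg q; move=> /(@fsbigN1 _ _ _ rat rat setT (fun q r => f r * g (q - r)) q)[r _].
rewrite mulf_eq0 negb_or => /andP[/Sf[i ri] /Sg[j qrj]].
exists (i + j)%N; rewrite -[q](subrK r) qrj ri /pt -mulrDl -intrD.
by congr (_%:~R / _); lia.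
Qed.

Lemma conv_pt f g d m m' k : (0 < d)%N -> supp d m f -> supp d m' g ->
  conv f g (pt d (m + m') k) =
  \sum_(i < k.+1) f (pt d m i) * g (pt d m' (k - i)).
Proof.
move=> d0 Sf Sg; rewrite /conv.
rewrite (fsbigE [seq pt d m i | i <- iota 0 k.+1]) //; first last.
- move=> r _; apply: contraNeq; rewrite mulf_eq0 negb_or => /andP[/Sf[i ri]].
  move=> /Sg[j]; rewrite ri => E; apply: map_f; rewrite mem_iota add0n.
  have : pt d (m + m') k = pt d (m + m') (i + j).
    rewrite -[LHS](subrK (pt d m i)) E /pt -mulrDl -intrD.
    by congr (_%:~R / _); lia.
  by move=> /(pt_inj d0); lia.
- by rewrite (map_inj_uniq (pt_inj d0)) iota_uniq.
rewrite big_map -[iota 0 k.+1]/(index_iota 0 k.+1) big_mkord.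
by apply: eq_big => i; rewrite ?in_setT // => _; rewrite ptB // -ltnS.
Qed.

Lemma is_puiseuxM a b : is_puiseux (conv a b).
Proof.
have [d [m [d0 Sa Sb]]] := supp_common2 (coef_puiseux a) (coef_puiseux b).
by apply/is_puiseuxP; exists d, (m + m); split=> //; apply: conv_supp.
Qed.

Definition puiseuxM a b := Puiseux (is_puiseuxM a b).

Lemma pmulC (u v : nat -> K) k :
  \sum_(i < k.+1) u i * v (k - i)%N = \sum_(i < k.+1) v i * u (k - i)%N.
Proof.
rewrite (reindex_inj rev_ord_inj) /=; apply: eq_bigr => i _.
by rewrite mulrC; congr (v _ * u _); have := ltn_ord i; lia.
Qed.

Lemma puiseux_mulC : commutative puiseuxM.
Proof.
move=> a b; apply: puiseux_ext => /=.
have [d [m [d0 Sa Sb]]] := supp_common2 (coef_puiseux a) (coef_puiseux b).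
apply: (eq_supp (d := d) (m := m + m)); try exact: conv_supp.
by move=> k; rewrite !conv_pt // (pmulC (a \o pt d m) (b \o pt d m)).
Qed.

Lemma pmulA (u v w : nat -> K) k :
  \sum_(i < k.+1) u i * (\sum_(j < (k - i).+1) v j * w (k - i - j)%N) =
  \sum_(i < k.+1) (\sum_(j < i.+1) u j * v (i - j)%N) * w (k - i)%N.
Proof.
pose P (x : nat -> K) : {poly K} := \poly_(i < k.+1) x i.
have PE x i : (i <= k)%N -> (P x)`_i = x i by move=> ik; rewrite coef_poly ltnS ik.
have := congr1 (fun p : {poly K} => p`_k) (mulrA (P u) (P v) (P w)).
rewrite !coefM => E; transitivity (\sum_(j < k.+1) (P u)`_j * (P v * P w)`_(k - j)).
  apply: eq_bigr => i _; rewrite coefM PE -1?ltnS //; congr (_ * _).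
  apply: eq_bigr => j _; have := ltn_ord i; have := ltn_ord j => ? ?.
  by rewrite !PE //; lia.
rewrite E; apply: eq_bigr => i _; have ? := ltn_ord i.
rewrite coefM PE; last lia; congr (_ * _).
by apply: eq_bigr => j _; have ? := ltn_ord j; rewrite !PE //; lia.
Qed.

Lemma puiseux_mulA : associative puiseuxM.
Proof.
move=> a b c; apply: puiseux_ext => /=.
have [d [m [d0 Sa Sb Sc]]] :=
  supp_common3 (coef_puiseux a) (coef_puiseux b) (coef_puiseux c).
have Sbc := conv_supp d0 Sb Sc; have Sab := conv_supp d0 Sa Sb.
have Sl := conv_supp d0 Sa Sbc; have Sr := conv_supp d0 Sab Sc.
apply: (eq_supp Sl); first by rewrite addrA.
move=> k; rewrite conv_pt // addrA conv_pt //.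
under eq_bigr => i _ do rewrite conv_pt //.
rewrite (pmulA (a \o pt d m) (b \o pt d m) (c \o pt d m)).
by apply: eq_bigr => i _; rewrite conv_pt.
Qed.

Lemma puiseux_mulD : left_distributive puiseuxM puiseuxD.
Proof.
move=> a b c; apply: puiseux_ext => /=.
have [d [m [d0 Sa Sb Sc]]] :=
  supp_common3 (coef_puiseux a) (coef_puiseux b) (coef_puiseux c).
have SD : supp d m (fun q => a q + b q).
  move=> q; have [->|/Sa//] := eqVneq (a q) 0; by rewrite add0r => /Sb.
apply: (eq_supp (conv_supp d0 SD Sc)).
  move=> q; have [->|/(conv_supp d0 Sa Sc)//] := eqVneq (conv a c q) 0.
  by rewrite add0r => /(conv_supp d0 Sb Sc).
move=> k; rewrite !conv_pt // -big_split; apply: eq_bigr => i _.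
by rewrite mulrDl.
Qed.

Lemma supp1 d : (0 < d)%N -> supp d 0 puiseux1.
Proof.
move=> d0 q /=; have [->|] := eqVneq q 0; last by rewrite eqxx.
by exists 0%N; rewrite /pt mul0r.
Qed.

Lemma puiseux1_pt d k : (0 < d)%N -> puiseux1 (pt d 0 k) = (k == 0%N)%:R.
Proof.
move=> d0 /=; rewrite /pt add0r mulf_eq0 invr_eq0 !pnatr_eq0.
by congr (_%:R); lia.
Qed.

Lemma puiseux_mul1 : left_id puiseux1 puiseuxM.
Proof.
move=> a; apply: puiseux_ext => /=.
have /is_puiseuxP[d [m [d0 Sa]]] := coef_puiseux a.
have S1 := supp1 d0; have S := conv_supp d0 S1 Sa.
apply: (eq_supp S); first by rewrite add0r.
move=> k; rewrite (conv_pt k d0 S1 Sa) add0r big_ord_recl puiseux1_pt //.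
rewrite mul1r subn0 big1 ?addr0 // => i _.
by rewrite puiseux1_pt // mul0r.
Qed.

Lemma puiseux_1_neq0 : puiseux1 != 0 :> puiseux K.
Proof.
by apply/eqP => /(congr1 (fun a => coef a 0)) /= /eqP; rewrite oner_eq0.
Qed.

HB.instance Definition _ := GRing.Zmodule_isComNzRing.Build (puiseux K)
  puiseux_mulA puiseux_mulC puiseux_mul1 puiseux_mulD puiseux_1_neq0.

Lemma pt_shift d m i k : pt d (m + i%:Z) k = pt d m (i + k).
Proof. by rewrite /pt; congr (_%:~R / _); lia. Qed.

Lemma supp_lead a : a != 0 ->
  exists d m, [/\ (0 < d)%N, supp d m a & a (pt d m 0) != 0].
Proof.
move=> a0; have /is_puiseuxP[d [m [d0 Sa]]] := coef_puiseux a.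
have ex : exists k, a (pt d m k) != 0.
  have [q aq] : exists q, a q != 0.
    apply: contrapT => /forallNP H; case/eqP: a0; apply: puiseux_ext => q /=.
    by have /negP := H q; rewrite negbK => /eqP.
  by have [k qk] := Sa _ aq; exists k; rewrite -qk.
case: (ex_minnP ex) => i ai imin.
exists d, (m + i%:Z); split=> //; last by rewrite pt_shift addn0.
move=> q aq; have [k qk] := Sa _ aq; exists (k - i)%N.
by rewrite pt_shift subnKC //; apply: imin; rewrite -qk.
Qed.

(* The first k coefficients of the inverse of the power series u. *)
Fixpoint invl (u : nat -> K) (k : nat) : seq K :=
  if k is k'.+1 then
    let s := invl u k' in
    rcons s ((u 0%N)^-1 * ((k' == 0%N)%:R - \sum_(i < k') u i.+1 * s`_(k' - i.+1)))
  else [::].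

Definition invs u k : K := (invl u k.+1)`_k.

Lemma size_invl u k : size (invl u k) = k.
Proof. by elim: k => //= k IH; rewrite size_rcons IH. Qed.

Lemma nth_invl u k i : (i < k)%N -> (invl u k)`_i = invs u i.
Proof.
elim: k => // k IH; rewrite ltnS leq_eqVlt => /orP[/eqP-> //|ik].
by rewrite /= nth_rcons size_invl ik IH.
Qed.

Lemma pmul_invs u k : u 0%N != 0 ->
  \sum_(i < k.+1) u i * invs u (k - i) = (k == 0%N)%:R.
Proof.
move=> u0; rewrite big_ord_recl subn0 {1}/invs /= nth_rcons size_invl ltnn eqxx.
rewrite mulrA divff // mul1r -addrA -[RHS]addr0; congr (_ + _).
apply/eqP; rewrite addrC subr_eq0; apply/eqP; apply: eq_bigr => i _.
by rewrite nth_invl //; have := ltn_ord i; lia.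
Qed.

Definition emb d m (u : nat -> K) (q : rat) : K :=
  \sum_(k \in [set k | pt d m k = q]) u k.

Lemma emb_pt d m u k : (0 < d)%N -> emb d m u (pt d m k) = u k.
Proof.
move=> d0; rewrite /emb -[RHS](@fsbig_set1 _ 0 +%R _ k u); apply: eq_fsbigl.
by apply/seteqP; split=> [i /(pt_inj d0)|i ->].
Qed.

Lemma supp_emb d m u : supp d m (emb d m u).
Proof. by move=> q /(@fsbigN1 _ _ _ rat nat [set k | pt d m k = q] (fun=> u) q)[k <- _];
  exists k. Qed.

Lemma puiseux_inv_exists a : a != 0 -> exists b, b * a = 1.
Proof.
move=> /supp_lead[d [m [d0 Sa a0]]].
pose u k := a (pt d m k).
have Sb := @supp_emb d (- m) (invs u).
have Pb : is_puiseux (emb d (- m) (invs u)).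
  by apply/is_puiseuxP; exists d, (- m).
exists (Puiseux Pb); rewrite mulrC; apply: puiseux_ext => /=.
have S := conv_supp d0 Sa Sb; rewrite subrr in S.
apply: (eq_supp S (supp1 d0)) => k.
rewrite -{1}(subrr m) conv_pt // puiseux1_pt // -(@pmul_invs u) //.
by apply: eq_bigr => i _; rewrite emb_pt.
Qed.

Definition puiseuxV a : puiseux K := xget 0 [set b | b * a = 1].

Lemma puiseux_mulV a : a != 0 -> puiseuxV a * a = 1.
Proof. by move=> /puiseux_inv_exists; apply: xgetPex. Qed.

Lemma puiseux_inv0 : puiseuxV 0 = 0.
Proof.
by apply: xgetPN => b /=; rewrite mulr0 => /esym/eqP; rewrite oner_eq0.
Qed.

HB.instance Definition _ := GRing.ComNzRing_isField.Build (puiseux K)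
  puiseux_mulV puiseux_inv0.

(* The valuation of a nonzero series is the exponent of its lowest-degree term;
   it is characterized by [pvalP].  By convention pval 0 = 0. *)
Definition pval a : rat :=
  xget 0 [set q | a q != 0 /\ forall r, a r != 0 -> q <= r].

Lemma pvalP a : a != 0 -> a (pval a) != 0 /\ forall r, a r != 0 -> pval a <= r.
Proof.
move=> /supp_lead[d [m [d0 Sa a0]]].
apply: (@xgetPex _ 0 [set q | a q != 0 /\ forall r, a r != 0 -> q <= r]).
exists (pt d m 0); split=> // r /Sa[k ->]; rewrite /pt.
apply: ler_wpM2r; first by rewrite invr_ge0 ler0n.
by rewrite ler_int; lia.
Qed.

End PuiseuxField.

Section Tropicalization.
Variable R : realType.
Local Open Scope complex_scope.

(* The subfield of real Puiseux series inside the complex ones. *)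
Definition real_puiseux : set (puiseux R[i]) :=
  [set a | exists b : puiseux R, forall q, a q = (b q)%:C].

(* The affine space of dimension m * n is presented as the m x n matrices.
   [S] is the subfield of coordinates ([setT] or [real_puiseux]), and the
   closure is taken for the product topology. *)
Definition trop (S : set (puiseux R[i])) m n (X : set 'M[puiseux R[i]]_(m, n)) :
    set 'M[R]_(m, n) :=
  closure ((fun x => \matrix_(i, j) ratr (pval (x i j))) @`
    [set x | X x /\ forall i j, S (x i j) /\ x i j != 0] : set 'M[R]_(m, n)).

End Tropicalization.

Definition singular_matrices (F : fieldType) n : set 'M[F]_n :=
  [set A | \det A = 0].

(* Main.v *)
From HB Require Import structures.
(* Before [Defs], whose [pval] would otherwise be shadowed by [perm.pval]. *)
From mathcomp Require Import fingroup perm.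
Require Import Defs.
From mathcomp Require Import all_boot all_order all_algebra.
From mathcomp Require Import all_classical all_reals topology.
From mathcomp Require Import complex.
From mathcomp Require Import lra.

(** If a matrix with nonzero entries is singular, the minimum [q] of the weights
    of permutations (sums of valuations of entries) is attained by two
    permutations [s] and [t], as otherwise the coefficient of the determinant at
    [q] would be a single nonzero product.  Conversely, choose [i] with
    [s i <> t i] and real monomial entries with the given valuations, whose
    coefficients are powers of 2 such that the permutations have pairwise
    distinct products.  The partial Leibniz sums [D1] over the permutations
    mapping [i] to [s i] and [D2] over the other ones both have valuation [q],
    because a signed sum of distinct powers of 2 does not vanish.  Multiplying
    the entry [(i, s i)] by [- D2 / D1] keeps its valuation and makes the
    determinant zero. *)

Section RealTropicalization.

Set Implicit Arguments.
Unset Strict Implicit.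
Unset Printing Implicit Defensive.

Import Order.TTheory GRing.Theory Num.Theory.

Local Open Scope classical_set_scope.
Local Open Scope ring_scope.

(** * Valuations and leading coefficients of Puiseux series *)

Section Valuation.
Variable K : fieldType.
Implicit Types a b : puiseux K.

Lemma pval_eq a q :
  a q != 0 -> (forall r, a r != 0 -> q <= r) -> pval a = q.
Proof.
move=> aq qle; have a0 : a != 0.
  by apply: contra_neq aq => ->.
have [av vle] := pvalP a0.
by apply/eqP; rewrite eq_le vle // qle.
Qed.

Lemma coef_lt_pval a q : q < pval a -> a q = 0.
Proof.
have [->//|a0] := eqVneq a 0.
move=> qlt; apply: contraTeq qlt => aq.
by rewrite -leNgt; apply: (pvalP a0).2.
Qed.

(** A nonzero term needs [pval a <= r] and [pval b <= q - r]; with the bound on [q] both are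
    equalities, so only [r = pval a] can contribute. *)
Lemma conv_lead a b q : a != 0 -> b != 0 -> q <= pval a + pval b ->
  conv a b q = if q == pval a + pval b then a (pval a) * b (pval b) else 0.
Proof.
move=> /pvalP[_ alow] /pvalP[_ blow] qle.
have sub r : a r * b (q - r) != 0 -> (r == pval a) && (q == pval a + pval b).
  rewrite mulf_eq0 negb_or => /andP[/alow ar /blow br].
  by apply/andP; split; lra.
rewrite /conv (fsbigE [:: pval a]) //; last first.
  by move=> r _; rewrite inE; apply: contraNeq => /sub/andP[].
rewrite big_mkcond big_seq1 in_setT; case: ifPn => [/eqP->|qn].
  by rewrite addrC addKr.
by apply: contraNeq qn => /sub/andP[].
Qed.

Lemma pvalM_lead a b : a != 0 -> b != 0 ->
  pval (a * b) = pval a + pval b /\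
  (a * b) (pval (a * b)) = a (pval a) * b (pval b).
Proof.
move=> a0 b0; have E := conv_lead a0 b0.
have L : (a * b) (pval a + pval b) = a (pval a) * b (pval b).
  by rewrite [LHS]E // eqxx.
have V : pval (a * b) = pval a + pval b.
  apply: pval_eq; first by rewrite L mulf_neq0 // (pvalP _).1.
  move=> r; apply: contraNT; rewrite -ltNge => rlt.
  by apply/eqP; rewrite [LHS]E ?ltW // lt_eqF.
by rewrite V L.
Qed.

Lemma pval1 : pval (1 : puiseux K) = 0.
Proof.
apply: pval_eq => [|r] /=; first by rewrite oner_eq0.
by have [->|] := eqVneq r 0; rewrite ?eqxx.
Qed.

Lemma pval_prod (I : finType) (F : I -> puiseux K) : (forall i, F i != 0) ->
  pval (\prod_i F i) = \sum_i pval (F i) /\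
  (\prod_i F i) (pval (\prod_i F i)) = \prod_i F i (pval (F i)).
Proof.
move=> F0; pose Q a q c := [/\ a != 0, pval a = q & a (pval a) = c].
suff [] : Q (\prod_i F i) (\sum_i pval (F i)) (\prod_i F i (pval (F i))) by [].
apply: (big_ind3 Q) => //.
- by split; rewrite ?oner_eq0 ?pval1.
- move=> a q c a' q' c' [a0 <- <-] [a'0 <- <-].
  by have [? ?] := pvalM_lead a0 a'0; split; rewrite ?mulf_neq0.
Qed.

Lemma pvalV a : a != 0 -> pval a^-1 = - pval a.
Proof.
move=> a0; have aV0 : a^-1 != 0 by rewrite invr_eq0.
have [+ _] := pvalM_lead a0 aV0; rewrite divff // pval1 => /esym/eqP.
by rewrite addrC addr_eq0 => /eqP.
Qed.

Lemma pvalN a : pval (- a) = pval a.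
Proof.
have [->|a0] := eqVneq a 0; first by rewrite oppr0.
have [av vle] := pvalP a0.
by apply: pval_eq => [|r] /=; rewrite oppr_eq0 //; apply: vle.
Qed.

Lemma coef_sum (I : finType) (P : pred I) (F : I -> puiseux K) q :
  (\sum_(i | P i) F i) q = \sum_(i | P i) F i q.
Proof. exact: (big_morph (fun a : puiseux K => a q)). Qed.

Lemma coef_sign (b : bool) a q : ((-1) ^+ b * a) q = (-1) ^+ b * a q.
Proof. by case: b; rewrite ?mulN1r ?mul1r. Qed.

Lemma is_puiseux_mono (c : K) q : is_puiseux (fun r => if r == q then c else 0).
Proof.
exists `|denq q|%N, (numq q); split; first by rewrite absz_gt0 denq_neq0.
move=> r; have [-> _|] := eqVneq r q; last by rewrite eqxx.
by exists (numq q) => //; rewrite -[LHS]divq_num_den natr_absz normr_denq.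
Qed.

Definition mono (c : K) q : puiseux K := Puiseux (is_puiseux_mono c q).

Lemma mono_lead (c : K) q : c != 0 ->
  [/\ mono c q != 0, pval (mono c q) = q & mono c q (pval (mono c q)) = c].
Proof.
move=> c0; have E : mono c q q = c by rewrite /= eqxx.
have V : pval (mono c q) = q.
  apply: pval_eq; first by rewrite E.
  by move=> r /=; have [->|] := eqVneq r q; rewrite ?eqxx.
by split; rewrite ?V //; apply: contra_neq c0 => M0; rewrite -E M0.
Qed.

(** * Leading terms of partial Leibniz sums *)

Section Leibniz.
Variables (n : nat) (A : 'M[puiseux K]_n).
Hypothesis A0 : forall i j, A i j != 0.

Definition weight (w : 'I_n -> 'I_n -> rat) (s : 'S_n) : rat :=
  \sum_k w k (s k).

(** For [predT] this is the determinant by conversion; a general [P] gives the two halves [D1] and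
    [D2]. *)
Definition leibniz (P : pred 'S_n) : puiseux K :=
  \sum_(s : 'S_n | P s) (-1) ^+ s * \prod_k A k (s k).

Let wt := weight (fun i j => pval (A i j)).

(** Each product has valuation [wt s >= q], so at [q] it contributes its leading coefficient if
    [wt s = q] and nothing otherwise. *)
Lemma coef_leibniz (P : pred 'S_n) q : (forall s, P s -> q <= wt s) ->
  leibniz P q = \sum_(s | P s && (wt s == q))
    (-1) ^+ s * \prod_k A k (s k) (pval (A k (s k))).
Proof.
move=> qle; rewrite coef_sum big_mkcondr; apply: eq_bigr => s Ps.
have [V L] : pval (\prod_k A k (s k)) = wt s /\ _ :=
  pval_prod (fun k => A0 k (s k)).
rewrite coef_sign -L; have [<-|ne] := eqVneq; first by rewrite -V.
by rewrite coef_lt_pval ?mulr0 // V lt_neqAle eq_sym ne qle.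
Qed.

Lemma pval_leibniz (P : pred 'S_n) q : (forall s, P s -> q <= wt s) ->
  \sum_(s | P s && (wt s == q))
    (-1) ^+ s * \prod_k A k (s k) (pval (A k (s k))) != 0 ->
  leibniz P != 0 /\ pval (leibniz P) = q.
Proof.
move=> qle; rewrite -coef_leibniz // => Lq; split.
  by apply: contra_neq Lq => ->.
apply: pval_eq => // r; apply: contraNT; rewrite -ltNge => rlt.
rewrite coef_leibniz => [|s Ps]; last by rewrite (le_trans (ltW rlt)) ?qle.
rewrite big_pred0 // => s; apply/negP => /andP[/qle + /eqP E].
by rewrite E leNgt rlt.
Qed.

Lemma singular_min_twice : \det A = 0 ->
  exists s t : 'S_n, [/\ s != t, wt s = wt t & forall u, wt s <= wt u].
Proof.
move=> detA; pose s := [arg min_(u < 1%g : 'S_n) wt u]%O.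
have smin u : wt s <= wt u by rewrite /s; case: arg_minP => // v _; apply.
have [t /andP[ts /eqP E]|uniq_s] := pickP (fun t => (t != s) && (wt t == wt s)).
  by exists s, t; split; rewrite // eq_sym.
suff [] : leibniz predT != 0 /\ pval (leibniz predT) = wt s.
  by rewrite [leibniz predT]detA eqxx.
apply: pval_leibniz => //; rewrite (big_pred1 s) => [|t] /=.
  rewrite mulf_neq0 ?signr_eq0 //; apply/prodf_neq0 => k _.
  exact: (pvalP (A0 _ _)).1.
by have := uniq_s t; case: eqVneq => [->|] //=; rewrite eqxx.
Qed.

End Leibniz.
End Valuation.

(** * Signed sums of distinct powers of 2, and numerical codes of permutations *)

Lemma sum_sign_exp2_neq0 (K : numDomainType) (I : finType) (P : pred I)
    (b : I -> bool) (e : I -> nat) (i0 : I) :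
  injective e -> P i0 -> \sum_(i | P i) (-1) ^+ b i * 2 ^+ e i != 0 :> K.
Proof.
move=> e_inj Pi0; pose j := [arg min_(i < i0 | P i) e i]%N.
have [Pj jmin] : P j /\ forall i, P i -> (e j <= e i)%N.
  by rewrite /j; case: arg_minnP.
(* The sum is the image of an integer; taking out the smallest power of 2 leaves exactly one odd
   term. *)
have -> : \sum_(i | P i) (-1) ^+ b i * 2 ^+ e i =
    (2 ^+ e j * \sum_(i | P i) (-1) ^+ b i * 2 ^+ (e i - e j))%:~R :> K.
  rewrite mulr_sumr rmorph_sum; apply: eq_bigr => i Pi.
  rewrite mulrCA -exprD subnKC ?jmin //.
  by rewrite rmorphM /= !rmorphXn /= rmorphN1.
rewrite intr_eq0 mulf_neq0 ?expf_neq0 // (bigD1 j) //= subnn mulr1.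
apply/eqP => /eqP; rewrite addr_eq0 => /eqP E.
have : (-1) ^+ b j \in dvdz 2.
  rewrite E rpredN; apply: rpred_sum => i /andP[Pi ij].
  have ej : e i != e j by apply: contra_neq ij => /e_inj.
  have := jmin _ Pi; rewrite leq_eqVlt eq_sym (negPf ej) -subn_gt0 /=.
  by case: (e i - e j)%N => // k _; rewrite exprS dvdz_mull // dvdz_mulr.
by case: (b j).
Qed.

(** Uniqueness of base-[n] expansions: reduction modulo [n] isolates the lowest digit, and division
    by [n] shifts the others. *)
Lemma digits_inj n m (f g : nat -> nat) :
    (forall k, (k < m)%N -> (f k < n)%N) -> (forall k, (k < m)%N -> (g k < n)%N) ->
    (\sum_(k < m) f k * n ^ k = \sum_(k < m) g k * n ^ k)%N ->
  forall k, (k < m)%N -> f k = g k.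
Proof.
elim: m f g => // m IH f g fn gn.
have split_sum (h : nat -> nat) : (\sum_(k < m.+1) h k * n ^ k =
    (\sum_(k < m) h k.+1 * n ^ k) * n + h 0)%N.
  rewrite big_ord_recl muln1 addnC big_distrl; congr (_ + _)%N.
  by apply: eq_bigr => k _; rewrite /= /bump add1n expnSr mulnA.
rewrite !split_sum => E; have f0 := fn 0%N isT; have g0 := gn 0%N isT.
have /(congr1 (modn^~ n)) := E; rewrite !modnMDl !modn_small // => E0.
have n0 : (0 < n)%N by exact: leq_trans f0.
case=> [//|k]; rewrite ltnS => km; apply: (IH (f \o S) (g \o S)) => //= [i|i|].
- exact: (fn i.+1).
- exact: (gn i.+1).
- by move: E; rewrite E0 => /addIn/eqP; rewrite eqn_pmul2r // => /eqP.
Qed.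

Lemma perm_code_inj n : injective (fun s : 'S_n => \sum_k s k * n ^ k)%N.
Proof.
move=> s t E; apply/perm.permP => k; apply/val_inj.
(* [digits_inj] takes digits indexed by [nat], so the values of [u] are extended by 0. *)
pose d (u : 'S_n) k := if insub k is Some i then val (u i) else 0%N.
have dE u (i : 'I_n) : d u i = u i by rewrite /d valK.
have dn u i : (i < n)%N -> (d u i < n)%N.
  by move=> lt_in; rewrite [d u i](dE u (Ordinal lt_in)).
rewrite /= -!dE; apply: (digits_inj (n := n) (m := n)) => //; try exact: dn.
by move: E => /=; under eq_bigr do rewrite -dE; under [RHS]eq_bigr do rewrite -dE.
Qed.

(** * Singular matrices with prescribed valuations *)

Lemma singular_of_min_twice (K : numFieldType) n (w : 'I_n -> 'I_n -> rat)
    (s t : 'S_n) :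
  s != t -> weight w s = weight w t -> (forall u, weight w s <= weight w u) ->
  exists B : 'M[puiseux K]_n,
    \det B = 0 /\ forall i j, B i j != 0 /\ pval (B i j) = w i j.
Proof.
move=> st wst smin.
have [i sti] : exists i, s i != t i.
  apply/existsP; apply: contra_neqT st => /existsPn st.
  by apply/perm.permP => i; apply/eqP; rewrite -[_ == _]negbK.
(* With these exponents the product along [v] is 2 to the code of [v] from [perm_code_inj]. *)
pose c (k l : 'I_n) : K := 2 ^+ (l * n ^ k).
have c0 k l : c k l != 0 by rewrite expf_neq0 // pnatr_eq0.
pose B := \matrix_(k, l) mono (c k l) (w k l).
have BP k l : [/\ B k l != 0, pval (B k l) = w k l &
    B k l (pval (B k l)) = c k l] by rewrite mxE; apply: mono_lead.
have B0 k l : B k l != 0 by case: (BP k l).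
have wB u : weight (fun k l => pval (B k l)) u = weight w u.
  by apply: eq_bigr => k _; case: (BP k (u k)).
have Bc (v : 'S_n) : \prod_k B k (v k) (pval (B k (v k))) =
    2 ^+ (\sum_k v k * n ^ k)%N.
  by rewrite -prodrXr; apply: eq_bigr => k _; case: (BP k (v k)).
have LP (P : pred 'S_n) u : P u -> weight w u = weight w s ->
    leibniz B P != 0 /\ pval (leibniz B P) = weight w s.
  move=> Pu Eu; apply: pval_leibniz => // [v _|]; first by rewrite wB.
  under eq_bigr do rewrite Bc.
  apply: (sum_sign_exp2_neq0 _ _ (@perm_code_inj n) (i0 := u)).
  by rewrite Pu wB Eu /=.
(* [s] and [t] witness that each of the two classes contains a permutation of minimal weight. *)
have [D10 V1] := LP [pred u : 'S_n | u i == s i] s (eqxx _) erefl.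
have [D20 V2] := LP [pred u : 'S_n | u i != s i] t (contra_neq esym sti) (esym wst).
set D1 := leibniz _ _ in D10 V1; set D2 := leibniz _ _ in D20 V2.
pose x := - D2 / D1.
have x0 : x != 0 by rewrite mulf_neq0 ?oppr_eq0 ?invr_eq0.
have Vx : pval x = 0.
  rewrite (pvalM_lead _ _).1 ?oppr_eq0 ?invr_eq0 //.
  by rewrite pvalN pvalV // V1 V2 subrr.
pose f k l := if (k == i) && (l == s i) then x else 1.
exists (\matrix_(k, l) (f k l * B k l)); split; last first.
  move=> k l; have [_ <- _] := BP k l; rewrite mxE /f; case: ifP => _.
    by rewrite mulf_neq0 // (pvalM_lead _ _).1 // Vx add0r.
  by rewrite mul1r.
(* Only the entry [(i, s i)] is rescaled: it occurs once in each product of [D1] and in none of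
   [D2]. *)
transitivity (x * D1 + D2); last by rewrite /x divfK ?addNr.
have prodf (u : 'S_n) : \prod_k f k (u k) = if u i == s i then x else 1.
  rewrite (bigD1 i) //= big1 => [|k ki]; rewrite /f ?(negPf ki) //.
  by rewrite eqxx mulr1.
have term (u : 'S_n) : \prod_k (\matrix_(k, l) (f k l * B k l)) k (u k) =
    (if u i == s i then x else 1) * \prod_k B k (u k).
  rewrite -prodf -big_split; apply: eq_bigr => k _; exact: mxE.
rewrite /determinant (bigID (fun u : 'S_n => u i == s i)) /=; congr (_ + _).
  rewrite mulr_sumr; apply: eq_bigr => u usi.
  by rewrite term usi mulrCA.
by apply: eq_bigr => u usi; rewrite term (negPf usi) mul1r.
Qed.

(** * Extension of the coefficient field *)

Section MapPuiseux.
Variables (K L : fieldType) (phi : {rmorphism K -> L}).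

Lemma is_puiseux_map (a : puiseux K) : is_puiseux (fun q => phi (a q)).
Proof.
case: (coef_puiseux a) => d [m [d0 S]]; exists d, m; split=> // q.
by rewrite fmorph_eq0; apply: S.
Qed.

Definition map_puiseux a : puiseux L := Puiseux (is_puiseux_map a).

Lemma supp_map d m (a : puiseux K) : supp d m a -> supp d m (map_puiseux a).
Proof. by move=> S q /=; rewrite fmorph_eq0; apply: S. Qed.

Lemma map_puiseux_is_additive : zmod_morphism map_puiseux.
Proof. by move=> a b; apply: puiseux_ext => q /=; rewrite rmorphB. Qed.

Lemma map_puiseux_is_multiplicative : monoid_morphism map_puiseux.
Proof.
split=> [|a b]; apply: puiseux_ext; first by move=> q /=; rewrite rmorph_nat.
have [d [m [d0 Sa Sb]]] := supp_common2 (coef_puiseux a) (coef_puiseux b).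
have Sab : supp d (m + m) (a * b) := conv_supp d0 Sa Sb.
apply: (eq_supp (supp_map Sab)).
  by apply: conv_supp => //; apply: supp_map.
move=> k; rewrite /= (conv_pt k d0 Sa Sb).
rewrite (conv_pt k d0 (supp_map Sa) (supp_map Sb)) rmorph_sum.
by apply: eq_bigr => i _; rewrite rmorphM.
Qed.

HB.instance Definition _ := GRing.isZmodMorphism.Build _ _ map_puiseux
  map_puiseux_is_additive.
HB.instance Definition _ := GRing.isMonoidMorphism.Build _ _ map_puiseux
  map_puiseux_is_multiplicative.

Lemma pval_map_puiseux a : pval (map_puiseux a) = pval a.
Proof.
have [->|a0] := eqVneq a 0; last have [av vle] := pvalP a0.
  (* At 0 both sets of candidate exponents are empty, so both valuations are the default value. *)
  rewrite raddf0; congr (xget _ _); apply/seteqP.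
  by split=> q [] /=; rewrite eqxx.
by apply: pval_eq => [|r] /=; rewrite fmorph_eq0 //; apply: vle.
Qed.

End MapPuiseux.

End RealTropicalization.

Theorem corollary4p2 (R : realType) (n : nat) :
  trop (@real_puiseux R) (@singular_matrices (puiseux R[i]) n) =
  trop [set: puiseux R[i]] (@singular_matrices (puiseux R[i]) n).
Proof.
(* The sets of valuations already agree before closure; one inclusion only forgets that the entries
   are real. *)
rewrite /trop; apply: congr1; apply/seteqP; split=> _ [A [/= detA AP] <-].
  by exists A => //; split=> // i j; case: (AP i j).
have A0 i j : A i j != 0%R by case: (AP i j).
have [s [t [st wst smin]]] := singular_min_twice A0 detA.
have [B [detB BP]] := singular_of_min_twice R st wst smin.
pose iota := map_puiseux (real_complex R).
exists (map_mx iota B); last first.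
  by apply/matrixP => i j; rewrite !mxE pval_map_puiseux (BP i j).2.
split=> [|i j] /=.
  by rewrite /singular_matrices /= det_map_mx detB GRing.rmorph0.
rewrite mxE; split; first by exists (B i j).
by rewrite GRing.fmorph_eq0 (BP i j).1.
Qed.
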